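(* Let $\Lambda\subset\mathbb R^2$ be a unimodular lattice, $\tau>0$ with $\mathcal F(\Lambda,\tau)\neq\emptyset$, and let $\begin{pmatrix}q_1 \\ a_1\end{pmatrix},\begin{pmatrix}q_2 \\ a_2\end{pmatrix}\in\mathcal F(\Lambda,\tau)$ be two primitive vectors with consecutive slopes. If $\alpha\in\left(\frac{a_1}{q_1},\frac{a_2}{q_2}\right)$, then the zippered rectangle decomposition $\mathfrak Z=(\lambda_1,\lambda_2,\lambda_3,h_1,h_2,h_3)$ of the torus $\mathbb R^2/s_{1/\tau}h_\alpha\cdot\Lambda$ over a marked unit length horizontal is given by $$\lambda_1=1-\frac{q_1}{\tau},\qquad \lambda_2=1-\lambda_1-\lambda_3=\frac{q_1+q_2}{\tau}-1,\qquad \lambda_3=1-\frac{q_2}{\tau},$$ $$h_1=\tau(\alpha q_1-a_1),\qquad h_2=h_1+h_3=\tau\big((a_2-\alpha q_2)-(a_1-\alpha q_1)\big),\qquad h_3=\tau(a_2-\alpha q_2).$$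
   Context: A unimodular lattice has covolume $1$. A nonzero $v\in\Lambda$ is primitive if the only lattice point in $\{rv\mid r\in[0,1)\}$ is the origin; $\Lambda_{\mathrm{prim}}$ is the set of primitive points. $S_\tau=(0,\tau]\times\mathbb R$ and $\mathcal F(\Lambda,\tau)=\Lambda_{\mathrm{prim}}\cap S_\tau$. Two points $\begin{pmatrix}q_1 \\ a_1\end{pmatrix},\begin{pmatrix}q_2 \\ a_2\end{pmatrix}\in\mathcal F(\Lambda,\tau)$ have consecutive slopes if $\frac{a_1}{q_1}<\frac{a_2}{q_2}$ and no point of $\mathcal F(\Lambda,\tau)$ has slope strictly in between. $h_s=\begin{pmatrix}1&0 \\ -s&1\end{pmatrix}$, $s_r=\begin{pmatrix}r&0 \\ 0&r^{-1}\end{pmatrix}$. Zippered rectangle decomposition of a torus $\mathbb R^2/M$ ($M$ a unimodular lattice) over a unit length horizontal segment $X$ (the image of $[x_0,x_0+1)\times\{y_0\}$): consider the first return map to $X$ of the unit speed upward vertical flow. The segment $X$ is divided, from left to right, into consecutive subintervals of lengths $\lambda_1,\lambda_2,\lambda_3$ (the widths; a width may be $0$, in which case that subinterval is absent), and on the $i$-th subinterval the first return time is the constant $h_i$ (the height). *)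

(* Defs.v *)
From HB Require Import structures.
From mathcomp Require Import all_boot all_order all_algebra.
From mathcomp Require Import all_classical all_reals.

Set Implicit Arguments.
Unset Strict Implicit.
Unset Printing Implicit Defensive.

Import Order.TTheory GRing.Theory Num.Theory.

Local Open Scope classical_set_scope.
Local Open Scope ring_scope.

Definition vec2 (R : realType) (x y : R) : 'cV[R]_2 :=
  \col_(i < 2) if i == 0 then x else y.

Definition mx2 (R : realType) (a b c d : R) : 'M[R]_2 :=
  \matrix_(i < 2, j < 2)
    if i == 0 then (if j == 0 then a else b) else (if j == 0 then c else d).

(* The columns of [B] are a Z-basis of [L]; the covolume is [`|\det B|], which
   does not depend on the choice of the basis. *)
Definition lattice_basis (R : realType) (B : 'M[R]_2) (L : set 'cV[R]_2) : Prop :=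
  B \in unitmx /\ L = [set B *m map_mx intr z | z in [set: 'cV[int]_2]].

Definition unimodular_lattice (R : realType) (L : set 'cV[R]_2) : Prop :=
  exists2 B : 'M[R]_2, lattice_basis B L & `|\det B| = 1.

Definition primitive_points (R : realType) (L : set 'cV[R]_2) : set 'cV[R]_2 :=
  [set v | [/\ L v, v != 0 &
    forall r : R, 0 <= r < 1 -> L (r *: v) -> r *: v = 0]].

Definition strip (R : realType) (tau : R) : set 'cV[R]_2 :=
  [set v | 0 < v 0 0 <= tau].

Definition farey_points (R : realType) (L : set 'cV[R]_2) (tau : R) :
    set 'cV[R]_2 :=
  primitive_points L `&` strip tau.

Definition slope (R : realType) (v : 'cV[R]_2) : R := v 1 0 / v 0 0.

Definition consecutive_slopes (R : realType) (F : set 'cV[R]_2)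
    (v w : 'cV[R]_2) : Prop :=
  [/\ F v, F w, slope v < slope w &
    forall u, F u -> ~ (slope v < slope u < slope w)].

Definition shear_mx (R : realType) (s : R) : 'M[R]_2 := mx2 1 0 (- s) 1.

Definition scale_mx (R : realType) (r : R) : 'M[R]_2 := mx2 r 0 0 r^-1.

Definition mx_image (R : realType) (A : 'M[R]_2) (L : set 'cV[R]_2) :
    set 'cV[R]_2 :=
  [set A *m v | v in L].

(* Points of the torus R^2 / M are represented by cosets of [M]. *)
Definition torus_proj (R : realType) (M : set 'cV[R]_2) (p : 'cV[R]_2) :
    set 'cV[R]_2 :=
  [set p + v | v in M].

(* Translation of a coset: [vflow s (torus_proj M p)] is the coset of
   [p + vec2 0 s]. *)
Definition vflow (R : realType) (s : R) (z : set 'cV[R]_2) : set 'cV[R]_2 :=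
  [set p + vec2 0 s | p in z].

Definition seg_point (R : realType) (M : set 'cV[R]_2) (x0 y0 t : R) :
    set 'cV[R]_2 :=
  torus_proj M (vec2 (x0 + t) y0).

Definition hsegment (R : realType) (M : set 'cV[R]_2) (x0 y0 : R) :
    set (set 'cV[R]_2) :=
  [set seg_point M x0 y0 t | t in [set t : R | 0 <= t < 1]].

Definition first_return_time (R : realType) (X : set (set 'cV[R]_2))
    (z : set 'cV[R]_2) (s : R) : Prop :=
  [/\ 0 < s, X (vflow s z) & forall s', 0 < s' < s -> ~ X (vflow s' z)].

(* The second clause says that the horizontal segment is embedded in the torus,
   so that its subintervals are well defined. If some [l_i] is zero, the
   corresponding [h_i] is not constrained. *)
Definition zippered_rectangle_decomposition (R : realType)
    (M : set 'cV[R]_2) (x0 y0 l1 l2 l3 h1 h2 h3 : R) : Prop :=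
  let X := hsegment M x0 y0 in
  let point := seg_point M x0 y0 in
  [/\ [/\ 0 <= l1, 0 <= l2, 0 <= l3 & l1 + l2 + l3 = 1],
      forall t t', 0 <= t < 1 -> 0 <= t' < 1 -> point t = point t' -> t = t',
      forall t, 0 <= t < l1 -> first_return_time X (point t) h1,
      forall t, l1 <= t < l1 + l2 -> first_return_time X (point t) h2 &
      forall t, l1 + l2 <= t < l1 + l2 + l3 ->
        first_return_time X (point t) h3].

(* Main.v *)
Require Import Defs.
From HB Require Import structures.
From mathcomp Require Import all_boot all_order all_algebra.
From mathcomp Require Import all_classical all_reals.
From mathcomp Require Import ring lra.

Set Implicit Arguments.
Unset Strict Implicit.
Unset Printing Implicit Defensive.

Import Order.TTheory GRing.Theory Num.Theory.

Local Open Scope classical_set_scope.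
Local Open Scope ring_scope.

(* Consecutive primitive vectors v, w form an oriented Z-basis of the lattice:
   complete v to a basis (v, u) with w = d u - r v and 0 <= r < d; if d > 1,
   then r > 0 because w is primitive, and u = (w + r v) / d lies in the strip
   with slope strictly between those of v and w.  Likewise v + w is primitive of intermediate slope, so it lies
   outside the strip, i.e. q1 + q2 > tau.  After renormalization the torus
   lattice is spanned by (- p1, h1) and (p2, h3) with p_i = q_i / tau <= 1 and
   p1 + p2 > 1.  The point at abscissa t returns to the segment at time s iff
   some lattice vector (x, s) has t - 1 < x <= t, and the lowest such vector is
   (- p1, h1), the sum of both, or (p2, h3), according to the position of t
   with respect to the two cut points 1 - p1 < p2. *)

(** * Plane vectors and oriented lattice bases *)

Lemma vec2_0 (R : realType) (x y : R) : vec2 x y 0 0 = x.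
Proof. by rewrite mxE. Qed.

Lemma vec2_1 (R : realType) (x y : R) : vec2 x y 1 0 = y.
Proof. by rewrite mxE. Qed.

Lemma cV2P (T : Type) (v w : 'cV[T]_2) : v 0 0 = w 0 0 -> v 1 0 = w 1 0 -> v = w.
Proof.
move=> e0 e1; apply/matrixP => i j; rewrite (ord1 j).
have [->|->] // : i = 0 \/ i = 1.
by case: i => [[|[|i]] lti] //; [left|right]; apply/val_inj.
Qed.

Lemma mulmx2E (R : pzRingType) (A : 'M[R]_2) (v : 'cV[R]_2) i :
  (A *m v) i 0 = A i 0 * v 0 0 + A i 1 * v 1 0.
Proof.
rewrite mxE big_ord_recl big_ord1; congr (_ + A i _ * v _ _);
  exact/val_inj.
Qed.

Definition cross (R : realType) (v w : 'cV[R]_2) : R :=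
  v 0 0 * w 1 0 - v 1 0 * w 0 0.

(** Normalizing [cross v w] to 1 makes the coefficient of [u] along [w] equal to [cross v u]. *)
Definition oriented_basis (R : realType) (L : set 'cV[R]_2) (v w : 'cV[R]_2) :=
  cross v w = 1 /\
  forall u, L u <-> exists m n : int, u = m%:~R *: v + n%:~R *: w.

Lemma det2E (R : comPzRingType) (A : 'M[R]_2) :
  \det A = A 0 0 * A 1 1 - A 0 1 * A 1 0.
Proof.
by rewrite (expand_det_row _ 0) big_ord_recl big_ord1 /cofactor !det_mx11 !mxE /=;
  rewrite expr0 mul1r expr1 mulN1r mulrN; congr (_ * A _ _ - A _ _ * A _ _);
  exact/val_inj.
Qed.

(** A common factor [g > 1] of the coordinates would put the shorter vector [v / g] in the lattice,
    against primitivity with [r = 1 / g]. *)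
Lemma primitive_coord_coprime (R : realType) (L : set 'cV[R]_2) B z :
  lattice_basis B L -> primitive_points L (B *m map_mx intr z) ->
  coprimez (z 0 0) (z 1 0).
Proof.
move=> [_ LE] [_ vn0 vprim]; rewrite /coprimez; set g := gcdz _ _.
have g0 : g != 0.
  apply: contraNneq vn0 => /eqP; rewrite gcdz_eq0 => /andP[/eqP z0 /eqP z1].
  suff -> : z = 0 by rewrite map_mx0 mulmx0.
  by apply: cV2P; rewrite ?z0 ?z1 !mxE.
have ggt0 : 0 < g by rewrite lt_neqAle eq_sym g0 /=.
apply: contraT => g1.
have {g1} g1 : 1 < g by rewrite lt_neqAle eq_sym g1 -gtz0_ge1.
have [z' zE] : exists z', z = g *: z'.
  exists (\col_i divz (z i 0) g).
  by apply: cV2P; rewrite !mxE mulrC divzK ?dvdz_gcdl ?dvdz_gcdr.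
have gR : g%:~R != 0 :> R by rewrite intr_eq0.
have gv : g%:~R^-1 *: (B *m map_mx intr z) = B *m map_mx intr z'.
  by rewrite zE map_mxZ -scalemxAr scalerA mulVf // scale1r.
have /eqP : g%:~R^-1 *: (B *m map_mx intr z) = 0.
  apply: vprim; last by rewrite gv LE; exists z'.
  by rewrite invr_ge0 ler0z ltW //= invf_lt1 ?ltr0z // ltr1z.
by rewrite scaler_eq0 invr_eq0 (negPf gR) (negPf vn0).
Qed.

(** Bezout coefficients of the coprime coordinates complete [z] to an integer matrix of determinant
    1 or -1. *)
Lemma primitive_oriented_basis (R : realType) (L : set 'cV[R]_2) v :
  unimodular_lattice L -> primitive_points L v ->
  exists w, oriented_basis L v w.
Proof.
move=> [B BL dB] vprim; have := vprim; have [_ LE] := BL.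
move=> [+ _ _]; rewrite {1}LE => -[z _ vE]; rewrite -vE in vprim *.
have /coprimezP[[u1 u2] /= uz] := primitive_coord_coprime BL vprim.
(* [e] is the sign of [\det B]; it corrects the orientation, as only the absolute value of the
   determinant is known. *)
have [e [e2 eB]] : exists e : int, e * e = 1 /\ e%:~R * \det B = 1.
  move: dB; case: (ger0P (\det B)) => _ d.
    by exists 1; rewrite d !mulr1.
  by exists (-1); split=> //; rewrite intrN mulN1r d.
exists (B *m map_mx intr (\col_i (if i == 0 then - e * u2 else e * u1))).
split.
  rewrite /cross !mulmx2E !mxE /=.
  transitivity (e%:~R * \det B * (u1 * z 0 0 + u2 * z 1 0)%:~R).
    by rewrite det2E intrD !intrM intrN; ring.
  by rewrite eB uz mulr1.
move=> u; rewrite LE; split => [[x _ <-]|[m [n ->]]]; last first.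
  exists (m *: z + n *: \col_i (if i == 0 then - e * u2 else e * u1)) => //.
  by rewrite map_mxD !map_mxZ mulmxDr -!scalemxAr.
(* Cramer's rule for the integer matrix with columns [z] and [e (- u2, u1)], whose determinant is
   [e]. *)
exists (u1 * x 0 0 + u2 * x 1 0), (e * (z 0 0 * x 1 0 - z 1 0 * x 0 0)).
rewrite !scalemxAr -mulmxDr -!map_mxZ -map_mxD; congr (B *m map_mx _ _).
apply: cV2P; rewrite !mxE /=.
  (* The identity holds modulo the Bezout relation and [e * e = 1]; the middle term makes both
     explicit. *)
  transitivity ((u1 * z 0 0 + u2 * z 1 0) * x 0 0
     + (1 - e * e) * (z 0 0 * x 1 0 - z 1 0 * x 0 0) * u2); last by ring.
  by rewrite uz e2 subrr; ring.
transitivity ((u1 * z 0 0 + u2 * z 1 0) * x 1 0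
   + (e * e - 1) * (z 0 0 * x 1 0 - z 1 0 * x 0 0) * u1); last by ring.
by rewrite uz e2 subrr; ring.
Qed.

Lemma crossDr (R : realType) (v w w' : 'cV[R]_2) :
  cross v (w + w') = cross v w + cross v w'.
Proof. by rewrite /cross !mxE; ring. Qed.

Lemma crossZr (R : realType) (v w : 'cV[R]_2) c :
  cross v (c *: w) = c * cross v w.
Proof. by rewrite /cross !mxE; ring. Qed.

Lemma crossvv (R : realType) (v : 'cV[R]_2) : cross v v = 0.
Proof. by rewrite /cross mulrC subrr. Qed.

Lemma oriented_basis_shear (R : realType) (L : set 'cV[R]_2) v w (k : int) :
  oriented_basis L v w -> oriented_basis L v (w + k%:~R *: v).
Proof.
move=> [c LE]; split; first by rewrite crossDr crossZr crossvv c; ring.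
move=> u; rewrite LE; split=> -[m [n ->]].
  exists (m - n * k), n; rewrite intrD intrN intrM.
  by apply: cV2P; rewrite !mxE; ring.
exists (m + n * k), n; rewrite intrD intrM.
by apply: cV2P; rewrite !mxE; ring.
Qed.

(** If [r *: w] lies in the lattice, its cross product with [v] shows that [r] is an integer, hence
    0 when [0 <= r < 1]. *)
Lemma oriented_basis_primitive (R : realType) (L : set 'cV[R]_2) v w :
  oriented_basis L v w -> primitive_points L w.
Proof.
move=> [c LE]; split.
- by apply/LE; exists 0, 1; rewrite scale0r add0r scale1r.
- by apply: contra_eqN c => /eqP ->; rewrite /cross !mxE !mulr0 subrr eq_sym oner_eq0.
move=> r r01 /LE [m [n e]]; have := congr1 (cross v) e.
rewrite crossDr !crossZr crossvv c mulr0 add0r !mulr1 => rn.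
move: r01; rewrite rn ler0z ltrz1 => /andP[n0 n1].
suff -> : n = 0 by rewrite scale0r.
by apply/eqP; rewrite eq_le n0 -ltzD1 add0r n1.
Qed.

Lemma slope_ltE (R : realType) (v w : 'cV[R]_2) :
  0 < v 0 0 -> 0 < w 0 0 -> (slope v < slope w) = (0 < cross v w).
Proof.
move=> v0 w0; rewrite /slope ltr_pdivrMr // mulrAC ltr_pdivlMr //.
by rewrite /cross subr_gt0 [w 1 0 * _]mulrC.
Qed.

(** * Primitive vectors with consecutive slopes *)

Section Consecutive.
Variables (R : realType) (L : set 'cV[R]_2) (tau : R) (v w : 'cV[R]_2).
Hypothesis unimL : unimodular_lattice L.
Hypothesis cons : consecutive_slopes (farey_points L tau) v w.

(** Signs of [cross] replace slope comparisons, so that bilinearity applies. *)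
Lemma consecutive_empty_cone u : primitive_points L u ->
  0 < u 0 0 <= tau -> 0 < cross v u -> 0 < cross u w -> False.
Proof.
have [[_ /andP[v0 _]] [_ /andP[w0 _]] _ sep] := cons.
move=> uL u0t vu uw; have /andP[u0 _] := u0t.
by apply: (sep u); [split | rewrite !slope_ltE// vu uw].
Qed.

Lemma consecutive_oriented_basis : oriented_basis L v w.
Proof.
have [[vL /andP[v0 vt]] [wL /andP[w0 wt]] + _] := cons.
rewrite slope_ltE // => vw.
have [b bas] := primitive_oriented_basis unimL vL.
have [c LE] := bas; have [Lw wn0 wmin] := wL.
have /LE[k [d wE]] := Lw.
have d0 : 0 < d.
  by move: vw; rewrite wE crossDr !crossZr crossvv c mulr0 add0r mulr1 ltr0z.
have dn0 : d%:~R != 0 :> R by rewrite intr_eq0 gt_eqF.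
(* Euclidean division of [- k] by [d]: shearing [b] by the quotient reduces the coefficient of [v]
   in [w] to [- r]. *)
set r := (- k %% d)%Z; set u := b + (- (- k %/ d)%Z)%:~R *: v.
have wu : w = d%:~R *: u - r%:~R *: v.
  have kE : k%:~R = - ((- k %/ d)%Z%:~R * d%:~R + r%:~R) :> R.
    by rewrite -intrM -intrD -divz_eq intrN opprK.
  by rewrite wE kE /u intrN; apply: cV2P; rewrite !mxE; ring.
have r0 : 0 <= r by rewrite modz_ge0 ?gt_eqF.
have rd : r < d by rewrite ltz_pmod.
have bas' : oriented_basis L v u by exact: oriented_basis_shear.
have [vu LE'] := bas'; have uL := oriented_basis_primitive bas'.
have uE : u = d%:~R^-1 *: (w + r%:~R *: v).
  by rewrite wu subrK scalerA mulVf ?scale1r.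
move: r0; rewrite le_eqVlt => /predU1P[r0|r0]; last first.
  exfalso; apply: (consecutive_empty_cone uL); last 1 first.
  - have -> : cross u w = d%:~R^-1 * r%:~R * cross v w.
      by rewrite uE /cross !mxE; ring.
    by rewrite !mulr_gt0 ?invr_gt0 ?ltr0z.
  - have rR : 0 < r%:~R :> R by rewrite ltr0z.
    have dR : 0 < d%:~R :> R by rewrite ltr0z.
    (* Integrality gives [r + 1 <= d], so the abscissa of [u] is at most
       [(1 + r) tau / d <= tau]. *)
    have rdR : r%:~R + 1 <= d%:~R :> R.
      by rewrite -[1]/(1%:~R) -intrD ler_int lezD1.
    rewrite uE !mxE mulr_gt0 ?invr_gt0 //=; last by nra.
    by rewrite mulrC ler_pdivrMr //; nra.
  by rewrite vu.
move: wu uE; rewrite -r0 !scale0r addr0 subr0 => wu uE.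
(* Now [w = d u], and primitivity of [w] excludes [d > 1]. *)
have d1 : d = 1.
  apply/eqP; rewrite eq_le -gtz0_ge1 d0 andbT leNgt; apply/negP => d1.
  have : d%:~R^-1 *: w = 0.
    apply: wmin; last by rewrite -uE; case: uL.
    by rewrite invr_ge0 ler0z ltW //= invf_lt1 ?ltr0z // ltr1z.
  by move=> /eqP; rewrite scaler_eq0 invr_eq0 (negPf dn0) (negPf wn0).
by rewrite wu d1 scale1r.
Qed.

Lemma consecutive_denominators : tau < v 0 0 + w 0 0.
Proof.
have [[vL /andP[v0 vt]] [wL /andP[w0 wt]] _ _] := cons.
have bas := consecutive_oriented_basis; have [c _] := bas.
have /oriented_basis_primitive := oriented_basis_shear 1 bas.
rewrite scale1r => pr; rewrite ltNge; apply/negP => le.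
apply: (consecutive_empty_cone pr).
- by rewrite !mxE addrC addr_gt0.
- by rewrite crossDr c crossvv addr0.
suff -> : cross (w + v) w = cross v w by rewrite c.
by rewrite /cross !mxE; ring.
Qed.

End Consecutive.

(** * The torus and returns to the horizontal segment *)

Lemma vec2_inj (R : realType) (x y x' y' : R) :
  vec2 x y = vec2 x' y' -> x = x' /\ y = y'.
Proof.
move=> e; split.
  by move: (congr1 (fun v : 'cV_2 => v 0 0) e); rewrite !vec2_0.
by move: (congr1 (fun v : 'cV_2 => v 1 0) e); rewrite !vec2_1.
Qed.

Lemma vec2B (R : realType) (x y x' y' : R) :
  vec2 x y - vec2 x' y' = vec2 (x - x') (y - y').
Proof. by apply: cV2P; rewrite !mxE. Qed.

Lemma torus_proj_eqP (R : realType) (M : set 'cV[R]_2) (p q : 'cV[R]_2) :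
  M 0 -> (forall u v, M u -> M v -> M (u - v)) ->
  torus_proj M p = torus_proj M q <-> M (p - q).
Proof.
move=> M0 MB.
have sub a b : M (a - b) -> torus_proj M a `<=` torus_proj M b.
  move=> ab _ [v Mv <-]; exists (v - (0 - (a - b))); first exact: MB Mv (MB _ _ M0 ab).
  by rewrite sub0r opprK addrCA subrKC addrC.
split=> [pq|pq]; last first.
  by apply/seteqP; split; apply: sub => //; rewrite -opprB -sub0r; exact: MB.
have : torus_proj M q p by rewrite -pq; exists 0; rewrite ?addr0.
by move=> [v Mv <-]; rewrite addrC addKr.
Qed.

Lemma vflow_torus_proj (R : realType) (M : set 'cV[R]_2) s (p : 'cV[R]_2) :
  vflow s (torus_proj M p) = torus_proj M (p + vec2 0 s).
Proof.
apply/seteqP; split=> u [].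
  by move=> _ [v Mv <-] <-; exists v; rewrite // addrAC.
by move=> v Mv <-; exists (p + v); [exists v | rewrite addrAC].
Qed.

(** A nonzero integer has absolute value at least 1. Bounding both products together leaves only
    linear arithmetic over the reals to its users. *)
Lemma intr_mul_trichotomy (R : numDomainType) (m : int) (p h : R) :
  0 < p -> 0 < h ->
  [\/ m%:~R * p <= - p /\ m%:~R * h <= - h,
      m%:~R * p = 0 /\ m%:~R * h = 0 |
      p <= m%:~R * p /\ h <= m%:~R * h].
Proof.
move=> p0 h0; have [m0|m0|->] := ltrgt0P m; last by apply: Or32; rewrite !mul0r.
  by apply: Or33; rewrite !ler_peMl ?ler1z -?gtz0_ge1 // ltW.
have m1 : m%:~R <= -1 :> R by rewrite -[-1]/((-1)%:~R) ler_int -ltzD1.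
by apply: Or31; rewrite -(mulN1r p) -(mulN1r h) !ler_wpM2r // ltW.
Qed.

Section Zippered.
Variables (R : realType) (M : set 'cV[R]_2) (x0 y0 p1 p2 h1 h3 : R).
Hypothesis ME : forall u, M u <-> exists m n : int,
  u = vec2 (n%:~R * p2 - m%:~R * p1) (m%:~R * h1 + n%:~R * h3).

Let point_eqP p q : torus_proj M p = torus_proj M q <-> M (p - q).
Proof.
apply: torus_proj_eqP.
  by apply/ME; exists 0, 0; apply: cV2P; rewrite !mxE /=; ring.
move=> _ _ /ME[m [n ->]] /ME[m' [n' ->]]; apply/ME; exists (m - m'), (n - n').
by rewrite !intrB; apply: cV2P; rewrite !mxE /=; ring.
Qed.

Lemma segment_returnP (t s : R) :
  hsegment M x0 y0 (vflow s (seg_point M x0 y0 t)) <->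
  exists m n : int, s = m%:~R * h1 + n%:~R * h3 /\
    t - 1 < n%:~R * p2 - m%:~R * p1 <= t.
Proof.
have dE t' : vec2 (x0 + t) y0 + vec2 0 s - vec2 (x0 + t') y0 = vec2 (t - t') s.
  by apply: cV2P; rewrite !mxE /=; ring.
rewrite /hsegment vflow_torus_proj; split.
  move=> [t' /andP[t'0 t'1]] /esym /point_eqP; rewrite dE => /ME[m [n]].
  move=> /vec2_inj[tE ->]; exists m, n; rewrite -tE; split=> //; apply/andP; split; lra.
(* The orbit lands at [t] minus the horizontal component of the lattice vector. *)
move=> [m [n [sE tE]]]; exists (t - (n%:~R * p2 - m%:~R * p1)) => /=.
  by apply/andP; split; lra.
apply/esym/point_eqP; rewrite dE; apply/ME; exists m, n.
by apply: cV2P; rewrite !mxE //=; ring.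
Qed.

(** Equal points differ by a horizontal lattice vector, [m h1 + n h3 = 0]. Unless both coefficients
    vanish, they have opposite signs, and the vector is at least [p1 + p2 > 1] long. *)
Lemma hsegment_inj (t t' : R) :
  0 < p1 -> 0 < p2 -> 1 < p1 + p2 -> 0 < h1 -> 0 < h3 -> 0 <= t < 1 ->
  0 <= t' < 1 -> seg_point M x0 y0 t = seg_point M x0 y0 t' -> t = t'.
Proof.
move=> p1_gt0 p2_gt0 p12 h1_gt0 h3_gt0 /andP[t0 t1] /andP[t'0 t'1] /point_eqP.
rewrite vec2B => /ME[m [n /vec2_inj[xE yE]]].
case: (intr_mul_trichotomy m p1_gt0 h1_gt0) => -[mp mh];
  case: (intr_mul_trichotomy n p2_gt0 h3_gt0) => -[np nh]; lra.
Qed.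

(** To exclude an earlier return: coefficients of opposite signs displace by at least [p1 + p2 > 1];
    both nonpositive give [s <= 0]; both positive give [s >= h1 + h3]. Positive multiples of a
    single generator come too late or miss the segment, depending on [t]. *)
Lemma zippered_rectangles :
  0 < p1 <= 1 -> 0 < p2 <= 1 -> 1 < p1 + p2 -> 0 < h1 -> 0 < h3 ->
  zippered_rectangle_decomposition M x0 y0
    (1 - p1) (p1 + p2 - 1) (1 - p2) h1 (h1 + h3) h3.
Proof.
move=> /andP[p1_gt0 p1_le1] /andP[p2_gt0 p2_le1] p12 h1_gt0 h3_gt0; split.
- by split; lra.
- by move=> t t'; exact: hsegment_inj.
- move=> t /andP[t0 t1]; split=> //.
    apply/segment_returnP; exists 1, 0; split; first by ring.
    by apply/andP; split; lra.
  move=> s /andP[s0 s1] /segment_returnP[m [n [sE /andP[lo up]]]].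
  case: (intr_mul_trichotomy m p1_gt0 h1_gt0) => -[mp mh];
  case: (intr_mul_trichotomy n p2_gt0 h3_gt0) => -[np nh]; lra.
- move=> t /andP[t0 t1]; split; first by lra.
    apply/segment_returnP; exists 1, 1; split; first by ring.
    by apply/andP; split; lra.
  move=> s /andP[s0 s1] /segment_returnP[m [n [sE /andP[lo up]]]].
  case: (intr_mul_trichotomy m p1_gt0 h1_gt0) => -[mp mh];
  case: (intr_mul_trichotomy n p2_gt0 h3_gt0) => -[np nh]; lra.
move=> t /andP[t0 t1]; split=> //.
  apply/segment_returnP; exists 0, 1; split; first by ring.
  by apply/andP; split; lra.
move=> s /andP[s0 s1] /segment_returnP[m [n [sE /andP[lo up]]]].
case: (intr_mul_trichotomy m p1_gt0 h1_gt0) => -[mp mh];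
  case: (intr_mul_trichotomy n p2_gt0 h3_gt0) => -[np nh]; lra.
Qed.

End Zippered.

(** * Renormalization of the lattice *)

Lemma renormalizeE (R : realType) (tau alpha : R) (v : 'cV[R]_2) :
  scale_mx (1 / tau) *m shear_mx alpha *m v =
  vec2 (v 0 0 / tau) (tau * (v 1 0 - alpha * v 0 0)).
Proof.
apply: cV2P; rewrite -mulmxA !mulmx2E !mxE /= ?invf_div ?divr1; ring.
Qed.

Theorem corollary7 (R : realType) (L : set 'cV[R]_2) (tau : R)
    (q1 a1 q2 a2 alpha x0 y0 : R) :
  unimodular_lattice L ->
  0 < tau ->
  farey_points L tau !=set0 ->
  consecutive_slopes (farey_points L tau) (vec2 q1 a1) (vec2 q2 a2) ->
  a1 / q1 < alpha < a2 / q2 ->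
  let M := mx_image (scale_mx (1 / tau) *m shear_mx alpha) L in
  let l1 := 1 - q1 / tau in
  let l2 := (q1 + q2) / tau - 1 in
  let l3 := 1 - q2 / tau in
  let h1 := tau * (alpha * q1 - a1) in
  let h2 := tau * ((a2 - alpha * q2) - (a1 - alpha * q1)) in
  let h3 := tau * (a2 - alpha * q2) in
  [/\ zippered_rectangle_decomposition M x0 y0 l1 l2 l3 h1 h2 h3,
      l2 = 1 - l1 - l3 &
      h2 = h1 + h3].
Proof.
move=> unimL tau0 _ cons /andP[alo aup] M l1 l2 l3 h1 h2 h3.
have h2E : h2 = h1 + h3 by rewrite /h1 /h2 /h3; ring.
have l2E : l2 = q1 / tau + q2 / tau - 1 by rewrite /l2 mulrDl.
split=> //; last by rewrite l2E /l1 /l3; ring.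
have := consecutive_denominators unimL cons; rewrite !vec2_0 => q12.
have [_ LE] := consecutive_oriented_basis unimL cons.
have [[_ +] [_ +] _ _] := cons.
rewrite /strip /= !vec2_0 => /andP[q10 q1t] /andP[q20 q2t].
rewrite h2E l2E; apply: zippered_rectangles.
(* The first vector has slope below [alpha], so its image [(p1, - h1)] points downwards; the upward
   generator is its opposite, whence [- m]. *)
- move=> u; split=> [[_ /LE[m [n ->]] <-]|[m [n ->]]].
    exists (- m), n; rewrite renormalizeE !mxE /= intrN /h1 /h3.
    by congr vec2; ring.
  exists ((- m)%:~R *: vec2 q1 a1 + n%:~R *: vec2 q2 a2).
    by apply/LE; exists (- m), n.
  rewrite renormalizeE !mxE /= intrN /h1 /h3.
  by congr vec2; ring.
- by rewrite divr_gt0 //= ler_pdivrMr ?mul1r.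
- by rewrite divr_gt0 //= ler_pdivrMr ?mul1r.
- by rewrite -mulrDl ltr_pdivlMr ?mul1r.
- by rewrite /h1 mulr_gt0 // subr_gt0 -ltr_pdivrMr.
- by rewrite /h3 mulr_gt0 // subr_gt0 -ltr_pdivlMr.
Qed.
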